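(* Let $m$ and $n$ be positive integers, and let $\mathcal{C}$ be an order $m$ dimension $n$ symmetric Cauchy tensor with generating vector $c=(c_1,c_2,\ldots,c_n)\in\mathbb{R}^n$. Let $\lambda_{\max}$ and $\lambda_{\min}$ denote the largest and smallest H-eigenvalues of $\mathcal{C}$, respectively. If the entries of $c$ have different signs, then $$\lambda_{\min}\le\frac{1}{m\max\{c_i\mid c_i<0,\ i\in[n]\}}<0<\frac{1}{m\min\{c_i\mid c_i>0,\ i\in[n]\}}\le\lambda_{\max}.$$
   Context: $[n]=\{1,\ldots,n\}$. An order $m$ dimension $n$ symmetric Cauchy tensor with generating vector $c=(c_1,\ldots,c_n)\in\mathbb{R}^n$ is the real tensor $\mathcal{C}=(c_{i_1\cdots i_m})$ with entries $c_{i_1i_2\cdots i_m}=\frac{1}{c_{i_1}+c_{i_2}+\cdots+c_{i_m}}$, $i_1,\ldots,i_m\in[n]$, where it is assumed that $c_{i_1}+\cdots+c_{i_m}\neq 0$ for all $i_1,\ldots,i_m\in[n]$ (so in particular all $c_i\neq 0$). The entries of $c$ having different signs means that $c$ has at least one positive and at least one negative entry. For a real symmetric tensor $\mathcal{T}=(t_{i_1\cdots i_m})$ of order $m$ and dimension $n$, a number $\lambda\in\mathbb{R}$ is an H-eigenvalue of $\mathcal{T}$ if there is a nonzero $x\in\mathbb{R}^n$ with $\sum_{i_2,\ldots,i_m\in[n]}t_{ii_2\cdots i_m}x_{i_2}\cdots x_{i_m}=\lambda x_i^{m-1}$ for all $i\in[n]$. The paper recalls that an even order real symmetric tensor alwa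ys has H-eigenvalues.
   Formalization: The order m is assumed even: for odd m the claim fails, e.g. m = 3, n = 2, c = (1, -1/10) has only positive H-eigenvalues (about 0.19 and 1.59), and for m = 1 with different signs no H-eigenvalue exists. *)

(* Defs.v *)
From mathcomp Require Import all_boot all_order all_algebra.
From mathcomp Require Import reals.

Set Implicit Arguments.
Unset Strict Implicit.
Unset Printing Implicit Defensive.

Import Order.TTheory GRing.Theory Num.Theory.

Local Open Scope ring_scope.

Definition tensor (R : realType) (m n : nat) : Type := m.-tuple 'I_n -> R.

Definition cauchy_generating (R : realType) (m n : nat) (c : 'rV[R]_n) : Prop :=
  forall I : m.-tuple 'I_n, \sum_(k <- I) c 0 k != 0.

Definition cauchy_tensor (R : realType) (m n : nat) (c : 'rV[R]_n) :
    tensor R m n :=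
  fun I => 1 / \sum_(k <- I) c 0 k.

Arguments cauchy_tensor {R} m {n} c _.

(* For m > 0, summing over the multi-indices I = (i, i_2, ..., i_m) whose head
   is i amounts to summing over all (i_2, ..., i_m) = behead I. *)
Definition H_eigenvalue (R : realType) (m n : nat) (T : tensor R m n) (l : R) :
    Prop :=
  exists x : 'rV[R]_n, x != 0 /\
    forall i : 'I_n,
      \sum_(I : m.-tuple 'I_n | ohead I == Some i)
        T I * \prod_(k <- behead I) x 0 k = l * x 0 i ^+ m.-1.

Definition largest_H_eigenvalue (R : realType) (m n : nat) (T : tensor R m n)
    (l : R) : Prop :=
  H_eigenvalue T l /\ forall l' : R, H_eigenvalue T l' -> l' <= l.

Definition smallest_H_eigenvalue (R : realType) (m n : nat) (T : tensor R m n)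
    (l : R) : Prop :=
  H_eigenvalue T l /\ forall l' : R, H_eigenvalue T l' -> l <= l'.

(* The hypothesis supplies the index that [arg max] and [arg min] need as a
   witness that their range is nonempty; the values do not depend on it. *)
Definition max_negative_entry (R : realType) (n : nat) (c : 'rV[R]_n)
    (i0 : 'I_n) (_ : c 0 i0 < 0) : R :=
  c 0 [arg max_(i > i0 | (c 0%R i < 0)%R) c 0%R i]%O.

Definition min_positive_entry (R : realType) (n : nat) (c : 'rV[R]_n)
    (j0 : 'I_n) (_ : 0 < c 0 j0) : R :=
  c 0 [arg min_(j < j0 | (0 < c 0%R j)%R) c 0%R j]%O.

(* Main.v *)
(* For even m and a symmetric tensor T of order m, the quotient
   T x^m / (x_1^m + ... + x_n^m) attains its maximum l, and every maximiser
   satisfies the H-eigenvalue equations for l.  Its value at a basis vector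
   e_i is the diagonal entry of T, here 1 / (m c_i), so the largest H-eigenvalue
   is at least each 1 / (m c_i); applying this to - T bounds the smallest one. *)

Require Import Defs.
From mathcomp Require Import all_boot all_order all_algebra.
From mathcomp Require Import reals.
From mathcomp Require Import boolp classical_sets topology normedtype derive
  realfun.

Import Order.TTheory GRing.Theory Num.Theory.
Import numFieldNormedType.Exports.

Local Open Scope ring_scope.

Definition tensor_form {R : realType} {m n : nat} (T : tensor R m n)
    (x : 'rV[R]_n) : R :=
  \sum_(I : m.-tuple 'I_n) T I * \prod_(k <- I) x 0 k.

Definition symmetric_tensor {R : realType} {m n : nat} (T : tensor R m n) :
    Prop :=
  forall I J : m.-tuple 'I_n, perm_eq I J -> T I = T J.

(** Leibniz rule. Since [rot p s] brings entry [p] to the head, [behead (rot p s)] is [s] without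
    that entry, up to order. This form matches the head/behead shape of the sums in
    [H_eigenvalue]. *)
Lemma deriv_prod_seq (R : comNzRingType) (K : Type) (k0 : K) (s : seq K)
    (F : K -> {poly R}) :
  (\prod_(k <- s) F k)^`() =
  \sum_(p < size s) (F (nth k0 s p))^`() * \prod_(k <- behead (rot p s)) F k.
Proof.
elim: s => [|k s IHs]; first by rewrite big_nil big_ord0 derivC.
rewrite big_cons derivM IHs big_ord_recl rot0; congr (_ + _).
rewrite mulr_sumr; apply: eq_bigr => p _.
rewrite mulrCA; congr (_ * _).
rewrite /= /bump /= add1n /rot /= (drop_nth k0) //= !big_cat big_cons /=.
by rewrite mulrCA.
Qed.

(** The polynomial is T z^m restricted to the line z = x + 'X e_i. Leibniz yields one sum per slot
    of the multi-index; by symmetry of [T] each of the [m] slots can be rotated to the front, so all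
    of these sums agree. *)
Lemma tensor_form_line_deriv0 (R : realType) (m n : nat) (T : tensor R m n)
    (T_sym : symmetric_tensor T) (x : 'rV[R]_n) (i : 'I_n) :
  (\sum_(I : m.-tuple 'I_n)
      (T I)%:P * \prod_(k <- I) ((x 0 k)%:P + (k == i)%:R%:P * 'X))^`().[0]
  = m%:R * \sum_(I : m.-tuple 'I_n | ohead I == Some i)
      T I * \prod_(k <- behead I) x 0 k.
Proof.
transitivity (\sum_(I : m.-tuple 'I_n) \sum_(p < m)
   T I * ((nth i I p == i)%:R * \prod_(k <- behead (rot p I)) x 0 k)).
  rewrite raddf_sum horner_sum; apply: eq_bigr => I _ /=.
  rewrite derivM derivC mul0r add0r hornerM hornerC -mulr_sumr; congr (_ * _).
  rewrite (deriv_prod_seq _ _ i) horner_sum size_tuple; apply: eq_bigr => p _.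
  rewrite hornerM horner_prod derivD derivC add0r derivM derivC derivX.
  rewrite mul0r add0r mulr1 hornerC; congr (_ * _).
  by apply: eq_bigr => k _; rewrite !hornerE.
(* With the slot [p] outermost, the factor [m] is spread as a constant sum over 'I_m, so that slots
   can be compared one by one. *)
rewrite exchange_big /= mulr_natl; set G := (X in _ = X *+ m).
rewrite -[m in RHS]card_ord -sumr_const {}/G.
apply: eq_bigr => p _.
have rotK : cancel (fun I : m.-tuple 'I_n => rot_tuple p I)
                   (fun I => rotr_tuple p I).
  by move=> I; apply: val_inj; rewrite /= rotK.
(* Reindexing by rotation turns the condition on the head into one on slot [p], and symmetry removes
   the rotation inside [T]. *)
rewrite [RHS](reindex_inj (can_inj rotK)) [RHS]big_mkcond /=.
apply: eq_bigr => I _.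
rewrite (T_sym (rot_tuple p I) I) ?perm_rot //.
rewrite /rot (drop_nth i) ?size_tuple //= (inj_eq Some_inj).
by case: eqP => _; rewrite ?mul1r // mul0r mulr0.
Qed.

Lemma diag_form_line_deriv0 (R : realType) (m n : nat) (x : 'rV[R]_n)
    (i : 'I_n) :
  (\sum_j ((x 0 j)%:P + (j == i)%:R%:P * 'X) ^+ m)^`().[0]
  = m%:R * x 0 i ^+ m.-1.
Proof.
rewrite raddf_sum horner_sum (bigD1 i) //= big1 ?addr0.
  rewrite eqxx mul1r deriv_exp derivD derivC derivX add0r mul1r.
  by rewrite hornerMn !hornerE mulr_natl.
move=> j /negPf ->.
by rewrite mul0r addr0 deriv_exp derivC mul0r mul0rn horner0.
Qed.

Lemma poly_max_deriv0 (R : realType) (p : {poly R}) (a : R) :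
  (forall t, p.[t] <= p.[a]) -> p^`().[a] = 0.
Proof.
move=> p_max.
have : is_derive a 1 (horner p) 0.
  apply: (@derive1_at_max _ _ (a - 1) (a + 1)) => //.
  - by rewrite lerD2l; apply: le_trans ler01; rewrite oppr_le0 ler01.
  - by rewrite in_itv /= ltrBlDr ltrDl ltr01.
by move=> der; rewrite derivE derive1E; apply: derive_val.
Qed.

Lemma tensor_formZ (R : realType) (m n : nat) (T : tensor R m n) (a : R)
    (x : 'rV[R]_n) :
  tensor_form T (a *: x) = a ^+ m * tensor_form T x.
Proof.
rewrite mulr_sumr; apply: eq_bigr => I _.
rewrite mulrCA; congr (_ * _).
under eq_bigr do rewrite mxE.
by rewrite big_split /= big_const_seq count_predT size_tuple iter_mulr_1.
Qed.

Lemma diag_form_gt0 (R : realType) (m n : nat) (x : 'rV[R]_n) :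
  ~~ odd m -> x != 0 -> 0 < \sum_j x 0 j ^+ m.
Proof.
move=> m_even /rV0Pn[i xi_neq0].
rewrite (bigD1 i) //= ltr_pwDl ?exprn_even_gt0 ?xi_neq0 ?orbT //.
by apply: sumr_ge0 => j _; rewrite exprn_even_ge0.
Qed.

Lemma tensor_form_continuous (R : realType) (m n : nat) (T : tensor R m n) :
  continuous (tensor_form T).
Proof.
apply: (@continuous_big R _ _ _ _ (@add_continuous R) _ _
  (fun (I : m.-tuple 'I_n) (x : 'rV[R]_n) => T I * \prod_(k <- I) x 0 k)).
move=> I _ x; apply: continuousM; first exact: cst_continuous.
apply: (@continuous_big R _ _ _ _ (@mul_continuous R) _ _
  (fun k (x : 'rV[R]_n) => x 0 k)).
by move=> k _; exact: coord_continuous.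
Qed.

Lemma diag_form_continuous (R : realType) (m n : nat) :
  continuous (fun x : 'rV[R]_n => \sum_j x 0 j ^+ m).
Proof.
apply: (@continuous_big R _ _ _ _ (@add_continuous R) _ _
  (fun j (x : 'rV[R]_n) => x 0 j ^+ m)).
move=> j _ x.
apply: (@continuous_comp _ _ _ (fun x : 'rV[R]_n => x 0 j) (fun y => y ^+ m)).
  exact: coord_continuous.
exact: exprn_continuous.
Qed.

(** Both forms are homogeneous of degree [m], so the quotient is constant on rays through 0 and a
    maximum over the compact unit sphere is global. Evenness of [m] keeps the denominator positive
    away from 0. *)
Lemma rayleigh_max (R : realType) (m n : nat) (T : tensor R m n) :
  (0 < n)%N -> ~~ odd m ->
  exists2 x : 'rV[R]_n, x != 0 &
    forall y, y != 0 -> tensor_form T y / (\sum_j y 0 j ^+ m)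
                        <= tensor_form T x / (\sum_j x 0 j ^+ m).
Proof.
move=> n_gt0 m_even.
pose f (x : 'rV[R]_n) := tensor_form T x / (\sum_j x 0 j ^+ m).
pose S := [set x : 'rV[R]_n | `|x| = 1]%classic.
have S_scale y : y != 0 -> S (`|y|^-1 *: y).
  by move=> y0; rewrite /S /= normrZ normfV normr_id mulVf ?normr_eq0.
have S_neq0 x : S x -> x != 0.
  by move=> Sx; rewrite -normr_eq0 Sx oner_eq0.
have S0 : (S !=set0)%classic.
  (* The normalised all-ones vector, nonzero because 0 < n. *)
  exists (`|const_mx 1 : 'rV[R]_n|^-1 *: const_mx 1); apply: S_scale.
  by apply/rV0Pn; exists (Ordinal n_gt0); rewrite mxE oner_eq0.
have S_compact : compact S.
  apply: bounded_closed_compact.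
    by exists 1; split=> [|M M1 x /= ->]; [exact: real1 | exact: ltW].
  apply: (@preimage_closed _ _ (fun x : 'rV[R]_n => `|x|) [set 1]%classic).
    by move=> x _; exact: norm_continuous.
  exact: closed_eq.
have f_cont : {within S, continuous f}%classic.
  apply: continuous_in_subspaceT => x /set_mem /S_neq0 x0.
  apply: continuousM; first exact: tensor_form_continuous.
  apply: continuousV; last exact: diag_form_continuous.
  by rewrite gt_eqF ?diag_form_gt0.
have [x /set_mem Sx x_max] := EVT_max_rV S0 S_compact f_cont.
exists x; first exact: S_neq0.
move=> y y0; apply: le_trans (x_max _ (mem_set (S_scale y y0))).
rewrite /f tensor_formZ.
have -> : \sum_j (`|y|^-1 *: y) 0 j ^+ m = `|y|^-1 ^+ m * \sum_j y 0 j ^+ m.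
  by rewrite mulr_sumr; apply: eq_bigr => j _; rewrite mxE exprMn.
by rewrite -mulf_div divff ?mul1r // expf_neq0 // invr_eq0 normr_eq0.
Qed.

(* No Lagrange multiplier is needed: if [l] is the maximum of the quotient,
   attained at [x], then the polynomial T z^m - l * (z_1^m + ... + z_n^m) has a
   global maximum 0 at [x], so it is stationary along each coordinate line. *)
Lemma tensor_form_le_H_eigenvalue (R : realType) (m n : nat)
    (T : tensor R m n) (T_sym : symmetric_tensor T) (y : 'rV[R]_n) :
  (0 < m)%N -> ~~ odd m -> y != 0 ->
  exists2 l, H_eigenvalue T l & tensor_form T y <= l * \sum_j y 0 j ^+ m.
Proof.
move=> m_gt0 m_even y0.
have n_gt0 : (0 < n)%N by have /rV0Pn[i _] := y0; case: (n) i => [[]|].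
have [x x0 x_max] := @rayleigh_max R m n T n_gt0 m_even.
set l := tensor_form T x / _ in x_max.
have form_le z : tensor_form T z <= l * \sum_j z 0 j ^+ m.
  have [->|z0] := eqVneq z 0.
    (* At z = 0 both sides vanish because 0 < m: writing 0 as 0 *: 0, homogeneity produces the
       factor 0 ^+ m. *)
    rewrite -(scale0r 0) tensor_formZ big1 => [|j _];
      by rewrite ?mxE ?mul0r expr0n gtn_eqF // ?mul0r ?mulr0.
  by rewrite -ler_pdivrMr ?diag_form_gt0 ?x_max.
exists l => //; exists x; split=> // i.
(* The difference of the two sides of [form_le] along the line x + t e_i: it is nowhere positive,
   and zero at t = 0 by the choice of [l]. *)
pose p := \sum_(I : m.-tuple 'I_n)
    (T I)%:P * \prod_(k <- I) ((x 0 k)%:P + (k == i)%:R%:P * 'X)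
  - l%:P * \sum_j ((x 0 j)%:P + (j == i)%:R%:P * 'X) ^+ m.
have pE t : p.[t] = tensor_form T (x + t *: delta_mx 0 i)
                    - l * \sum_j (x + t *: delta_mx 0 i) 0 j ^+ m.
  have lineE k : ((x 0 k)%:P + (k == i)%:R%:P * 'X).[t]
                 = (x + t *: delta_mx 0 i) 0 k.
    by rewrite !hornerE !mxE eqxx mulrC.
  rewrite hornerD hornerN hornerM hornerC !horner_sum; congr (_ - l * _).
    apply: eq_bigr => I _; rewrite hornerM hornerC horner_prod.
    by congr (_ * _); apply: eq_bigr => k _; rewrite lineE.
  by apply: eq_bigr => j _; rewrite horner_exp lineE.
have p'0 : p^`().[0] = 0.
  apply: poly_max_deriv0 => t; rewrite !pE scale0r addr0.
  by rewrite divfK ?gt_eqF ?diag_form_gt0 // subrr subr_le0.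
(* Stationarity of [p] at 0 is [m] times the i-th eigenvalue equation. *)
apply/(mulfI (_ : m%:R != 0 :> R)); first by rewrite pnatr_eq0 -lt0n.
apply/eqP; rewrite -tensor_form_line_deriv0 // mulrCA.
rewrite -(diag_form_line_deriv0 R m) -subr_eq0; apply/eqP; rewrite -[RHS]p'0.
rewrite derivD derivN derivM derivC mul0r add0r.
by rewrite hornerD hornerN hornerM hornerC.
Qed.

Lemma cauchy_tensor_sym (R : realType) (m n : nat) (c : 'rV[R]_n) :
  symmetric_tensor (cauchy_tensor m c).
Proof. by move=> I J IJ; rewrite /cauchy_tensor (perm_big _ IJ). Qed.

Lemma H_eigenvalueN (R : realType) (m n : nat) (T : tensor R m n) (l : R) :
  H_eigenvalue (fun I => - T I) l -> H_eigenvalue T (- l).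
Proof.
move=> [x [x0 xP]]; exists x; split=> // i.
rewrite mulNr -xP -sumrN; apply: eq_bigr => I _.
by rewrite mulNr opprK.
Qed.

Lemma tensor_form_delta (R : realType) (m n : nat) (T : tensor R m n)
    (i : 'I_n) :
  tensor_form T (delta_mx 0 i) = T (nseq_tuple m i).
Proof.
rewrite /tensor_form (bigD1 (nseq_tuple m i)) //= big1_seq => [|k].
  rewrite mulr1 big1 ?addr0 // => I I_neq.
  (* A multi-index that is not constantly [i] has an entry k != i, where e_i contributes a zero
     factor. *)
  have /allPn[k kI /= ki] : ~~ all (pred1 i) I.
    apply: contra I_neq => /all_pred1P; rewrite size_tuple => eqI.
    exact/eqP/val_inj.
  apply/eqP; rewrite mulf_eq0 prodf_seq_eq0; apply/orP; right.
  by apply/hasP; exists k => //=; rewrite mxE (negPf ki) andbF.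
by case/andP=> _ /nseqP[-> _]; rewrite mxE !eqxx.
Qed.

Lemma diag_form_delta (R : realType) (m n : nat) (i : 'I_n) :
  (0 < m)%N -> \sum_j (delta_mx 0 i : 'rV[R]_n) 0 j ^+ m = 1.
Proof.
move=> m_gt0; rewrite (bigD1 i) //= mxE !eqxx expr1n big1 ?addr0 // => j ji.
by rewrite mxE (negPf ji) andbF expr0n gtn_eqF.
Qed.

Lemma cauchy_tensor_diag (R : realType) (m n : nat) (c : 'rV[R]_n)
    (i : 'I_n) :
  cauchy_tensor m c (nseq_tuple m i) = 1 / (m%:R * c 0 i).
Proof.
rewrite /cauchy_tensor /= big_nseq; congr (_ / _).
by rewrite iter_addr_0 mulr_natl.
Qed.

Lemma delta_mx_neq0 (R : realType) (n : nat) (i : 'I_n) :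
  (delta_mx 0 i : 'rV[R]_n) != 0.
Proof. by apply/rV0Pn; exists i; rewrite mxE !eqxx oner_eq0. Qed.

(** Evaluation at e_i, where the sum of m-th powers is 1. Producing some eigenvalue above the entry
    suits both ends of the spectrum: it is applied to the tensor and to its opposite. *)
Lemma diag_entry_le_H_eigenvalue (R : realType) (m n : nat) (T : tensor R m n)
    (i : 'I_n) :
  symmetric_tensor T -> (0 < m)%N -> ~~ odd m ->
  exists2 l, H_eigenvalue T l & T (nseq_tuple m i) <= l.
Proof.
move=> T_sym m_gt0 m_even.
have [l Tl] := tensor_form_le_H_eigenvalue _ _ _ _ T_sym _ m_gt0 m_even
  (delta_mx_neq0 R n i).
by rewrite tensor_form_delta diag_form_delta // mulr1; exists l.
Qed.

Theorem lemma3p1 (R : realType) (m n : nat)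
    (m_gt0 : (0 < m)%N) (n_gt0 : (0 < n)%N) (m_even : ~~ odd m)
    (c : 'rV[R]_n) (c_gen : cauchy_generating m c)
    (lmin lmax : R)
    (lmin_smallest : smallest_H_eigenvalue (cauchy_tensor m c) lmin)
    (lmax_largest : largest_H_eigenvalue (cauchy_tensor m c) lmax)
    (i0 j0 : 'I_n) (ci0_neg : c 0 i0 < 0) (cj0_pos : 0 < c 0 j0) :
  [/\ lmin <= 1 / (m%:R * max_negative_entry ci0_neg),
      1 / (m%:R * max_negative_entry ci0_neg) < 0,
      0 < 1 / (m%:R * min_positive_entry cj0_pos) &
      1 / (m%:R * min_positive_entry cj0_pos) <= lmax].
Proof.
have T_sym := cauchy_tensor_sym R m n c.
rewrite /max_negative_entry /min_positive_entry.
(* The extremal indices [i] and [j] come with the signs of their entries, which settle the two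
   middle inequalities; the outer two are diagonal-entry bounds at [i] and [j]. *)
case: arg_maxP => // i ci_neg _; case: arg_minP => // j cj_pos _.
split.
- rewrite -cauchy_tensor_diag.
  have NT_sym : symmetric_tensor (fun I => - cauchy_tensor m c I).
    by move=> I J IJ; rewrite (T_sym I J).
  have [l /H_eigenvalueN Tl] :=
    diag_entry_le_H_eigenvalue _ _ _ _ i NT_sym m_gt0 m_even.
  rewrite lerNl; apply: le_trans; exact: (lmin_smallest.2 _ Tl).
- by rewrite div1r invr_lt0 pmulr_rlt0 ?ltr0n.
- by rewrite div1r invr_gt0 mulr_gt0 ?ltr0n.
- rewrite -cauchy_tensor_diag.
  have [l Tl] := diag_entry_le_H_eigenvalue _ _ _ _ j T_sym m_gt0 m_even.
  move/le_trans; apply; exact: (lmax_largest.2 _ Tl).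
Qed.
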